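(* Let $\mu_*\in\mathbb{R}$ be arbitrary and let $\Gamma:B\to B$ satisfy (a) and (b) of the context. Consider the equation $$\mu_*\,x\,w'(x)+w(x)=g(x),\qquad g=\Gamma(w). \tag{E}$$ Assume that there exists a continuous function $w_0(x)$, $x\ge0$, such that (i) $\|w_0\|\le1$, and (ii) $$\int_0^1dt\,g_0(xt^{\mu_*})=w_0(x)+O(x^p),\qquad g_0=\Gamma(w_0),$$ with some $p>0$, $p\mu_*>-1$, satisfying the inequality $$\mu(p)=\frac1p\Big[\int_0^\infty da\,K(a)a^p-1\Big]<\mu_*.$$ Then there exists a classical solution $w(x)$ of equation (E). The solution is unique in the class of continuous functions satisfying $$\|w\|\le1,\qquad w(x)=w_0(x)+O(x^{p_1}),$$ with any $p_1>0$ such that $\mu(p_1)<\mu_*$.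
   Context: $\mathbb{R}_+=[0,\infty)$; $B=C(\mathbb{R}_+)$ is the Banach space of bounded continuous real-valued functions on $\mathbb{R}_+$ with the sup norm; $U=\{u\in B:\|u\|\le1\}$. The conditions are: (a) $\Gamma(U)\subset U$. (b) $\Gamma$ is $L$-Lipschitz: for all $u_1,u_2\in U$ and all $x\ge0$, $|\Gamma(u_1)-\Gamma(u_2)|(x)\le L(|u_1-u_2|)(x)$, where $Lu(x)=\int_0^\infty da\,K(a)u(ax)$ and $K\ge0$ is a generalized function (i.e. $K(a)da$ is a finite nonnegative Borel measure on $\mathbb{R}_+$) such that $0<\lambda(p):=\int_0^\infty da\,K(a)a^p<\infty$ for all $p\ge0$. The spectral function is $\mu(p)=(\lambda(p)-1)/p$, $p>0$. The notation $y=O(x^p)$ means that there is a constant $C>0$ with $|y(x)|\le Cx^p$ for all $x\ge0$. A classical solution $w$ of (E) is a function in $B$ which, if $\mu_*\neq0$, is continuously differentiable on $(0,\infty)$ and satisfies (E) for $x>0$ (if $\mu_*=0$, (E) reads $w=\Gamma(w)$). For functions $w$ with $\|w\|<\infty$, (E) is understood equivalently in the integral form $w(x)=\int_0^1d\tau\,g(x\tau^{\mu_*})$, $g=\Gamma(w)$, $x\ge0$. *)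

(* Defs.v *)
From HB Require Import structures.
From mathcomp Require Import all_boot all_order all_algebra.
From mathcomp Require Import all_classical all_reals all_analysis.
Set Implicit Arguments.
Unset Strict Implicit.
Unset Printing Implicit Defensive.
Import Order.TTheory GRing.Theory Num.Theory.
Import numFieldNormedType.Exports.
Local Open Scope classical_set_scope.
Local Open Scope ring_scope.

Definition Rplus (R : realType) : set R := [set x | 0 <= x].
Arguments Rplus {R}.

(* Functions on [0, oo[ are represented by total functions R -> R of which only
   the values on [0, oo[ are meaningful: continuity, norm, equations and
   equalities are all taken on [0, oo[. *)

(* Valued in \bar R, hence meaningful (+oo) for unbounded functions too. *)
Definition supnorm (R : realType) (u : R -> R) : \bar R :=
  ereal_sup [set `|u x|%:E | x in Rplus].

Definition B (R : realType) : set (R -> R) :=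
  [set u | {within Rplus, continuous u} /\ (supnorm u < +oo)%E].
Arguments B R : clear implicits.

Definition U (R : realType) : set (R -> R) :=
  [set u | B R u /\ (supnorm u <= 1)%E].
Arguments U R : clear implicits.

(* A finite Borel measure on [0, oo[ is given by a finite Borel measure K on R
   that is only ever integrated over [0, oo[. *)

Definition Lop (R : realType)
    (K : {finite_measure set (measurableTypeR R) -> \bar R})
    (u : R -> R) (x : R) : R :=
  (\int[K]_(a in Rplus) u (a * x))%R.

(* 0 `^ 0 = 1, so lambda K 0 is the total mass of K on [0, oo[, including a
   possible atom at 0. *)
Definition lambda (R : realType)
    (K : {finite_measure set (measurableTypeR R) -> \bar R}) (p : R) : \bar R :=
  (\int[K]_(a in Rplus) (a `^ p)%:E)%E.

Definition spectral (R : realType)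
    (K : {finite_measure set (measurableTypeR R) -> \bar R}) (p : R) : R :=
  (fine (lambda K p) - 1) / p.

(* For u1 and u2 in U that agree on [0, oo[, the right-hand side vanishes, so G
   then induces a map on (the unit ball of) functions on [0, oo[. *)
Definition L_Lipschitz (R : realType)
    (K : {finite_measure set (measurableTypeR R) -> \bar R})
    (G : (R -> R) -> (R -> R)) : Prop :=
  forall u1 u2, U R u1 -> U R u2 -> forall x : R, 0 <= x ->
    `|G u1 x - G u2 x| <= Lop K (fun y => `|u1 y - u2 y|) x.

Definition bigO_pow (R : realType) (y : R -> R) (p : R) : Prop :=
  exists2 C : R, 0 < C & forall x : R, 0 <= x -> `|y x| <= C * x `^ p.

(* For m < 0 the value of t `^ m at t = 0 is a junk value, on a null set. *)
Definition dilation_mean (R : realType) (m : R) (g : R -> R) (x : R) : R :=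
  (\int[lebesgue_measure]_(t in `[0, 1]) g (x * t `^ m))%R.

Definition classical_solution (R : realType) (G : (R -> R) -> (R -> R)) (m : R)
    (w : R -> R) : Prop :=
  B R w /\
  if m == 0 then forall x : R, 0 <= x -> w x = G w x
  else [/\ forall x : R, 0 < x -> derivable w x 1,
           forall x : R, 0 < x -> {for x, continuous (derive1 w)}
         & forall x : R, 0 < x -> m * x * derive1 w x + w x = G w x].

Definition integral_solution (R : realType) (G : (R -> R) -> (R -> R)) (m : R)
    (w : R -> R) : Prop :=
  B R w /\ forall x : R, 0 <= x -> w x = dilation_mean m (G w) x.

(* Main.v *)
(* The map A u = (x |-> \int_0^1 Gamma(u)(x t^mus) dt) contracts the weighted
   distance sup |u1 - u2| / x^q by the factor k = lambda(q) / (1 + q mus), and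
   k < 1 is exactly the spectral condition mu(q) < mus; it also forces
   q mus > -1, so that t^(q mus) is integrable at 0. Picard iteration from w0
   then converges geometrically at each point, locally uniformly, to a fixed
   point w = w0 + O(x^p). Two solutions are both w0 + O(x^q) for
   q = min(p, p1), and iterating the contraction on their difference shows that
   they agree. Fixed points are classical solutions because
   c A(u)(c^mus) = \int_0^c Gamma(u)(s^mus) ds, whatever the sign of mus. *)
Require Import Defs.
From HB Require Import structures.
From mathcomp Require Import all_boot all_order all_algebra.
From mathcomp Require Import all_classical all_reals all_analysis.
From mathcomp Require Import measurable_realfun ring lra.
Set Implicit Arguments.
Unset Strict Implicit.
Unset Printing Implicit Defensive.
Import Order.TTheory GRing.Theory Num.Theory.
Import numFieldNormedType.Exports.
Local Open Scope classical_set_scope.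
Local Open Scope ring_scope.

(** * Functions on the half-line and the unit ball *)

(* Composing with the norm extends a function on [0, oo[ evenly to the real line,
   which replaces continuity within Rplus by plain continuity. *)
Lemma continuous_Rplus_norm (R : realType) (u : R -> R) :
  {within Rplus, continuous u} <-> continuous (fun x : R => u `|x|).
Proof.
split=> [cu x|cu].
- have nx : Rplus `|x| by rewrite /Rplus/=.
  move/subspace_continuousP : cu => /(_ _ nx) cu.
  apply: (@cvg_comp _ _ _ (fun x : R => `|x|) u (nbhs x)
    (within Rplus (nbhs `|x|))) => //.
  move=> A /= [e e0 eA].
  exists e => // y xy; apply: eA => /=; last by rewrite /Rplus/=.
  exact: le_lt_trans (ler_dist_dist _ _) xy.
- apply/subspace_continuousP => x x0.
  have {}cu : u `|y| @[y --> within Rplus (nbhs x)] --> u x.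
    have := cu x; rewrite /continuous_at ger0_norm//; apply: cvg_trans.
    exact/cvg_app/cvg_within.
  apply: cvg_trans cu; apply: near_eq_cvg.
  by near=> y; rewrite ger0_norm//; near: y; exact: withinT.
Unshelve. all: by end_near. Qed.

Lemma supnorm_le1 (R : realType) (u : R -> R) :
  (supnorm u <= 1)%E <-> forall x, 0 <= x -> `|u x| <= 1.
Proof.
split=> [u1 x x0|u1].
  rewrite -lee_fin; apply: le_trans u1; apply: ereal_sup_ubound.
  by exists x.
by apply: ge_ereal_sup => _ [x x0 <-]; rewrite lee_fin u1.
Qed.

Lemma in_U (R : realType) (u : R -> R) :
  {within Rplus, continuous u} -> (supnorm u <= 1)%E -> U R u.
Proof.
by move=> cu u1; split => //; split => //; rewrite (le_lt_trans u1)// ltry.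
Qed.

(** * Growth from 0 and geometric increments *)

(** On each [t, c] with 0 < t the function does not decrease, so F t <= F c; then t tends to 0 from
    the right. Only the limit of F at 0 enters, so F may fail to be differentiable there. *)
Lemma derive_nonneg_at0 (R : realType) (F F' : R -> R) :
  (forall t : R, 0 < t -> is_derive t 1 F (F' t)) ->
  (forall t : R, 0 < t -> 0 <= F' t) -> F t @[t --> 0^'+] --> 0 ->
  forall c : R, 0 < c -> 0 <= F c.
Proof.
move=> dF F'0 F0 c c0; apply: (cvgr_to_le F0).
near=> t; have t0 : 0 < t by [].
have tc : t <= c by near: t; exact: nbhs_right_le.
have dF' x : x \in `]t, c[ -> is_derive x 1 F (F' x).
  by rewrite in_itv/= => /andP[tx _]; apply: dF; exact: lt_trans tx.
apply: (@ger0_derive1_ndecr _ F t c) => //.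
- by move=> x /dF' [].
- move=> x xtc; have [_ h] := dF' _ xtc.
  rewrite derive1E h F'0//; move: xtc; rewrite in_itv/= => /andP[tx _].
  exact: lt_trans tx.
- apply: derivable_within_continuous => x; rewrite in_itv/= => /andP[tx _].
  by have [] := dF x (lt_le_trans t0 tx).
Unshelve. all: by end_near. Qed.

(* The limit is the common point of the nested intervals
   [a n - e n, a n + e n], where e n = D / (1 - k) * k ^+ n. *)
Lemma geometric_increments_cvg (R : realType) (a : nat -> R) (D k : R) :
  0 <= k < 1 -> (forall n, `|a n.+1 - a n| <= D * k ^+ n) ->
  exists l, forall n, `|l - a n| <= D / (1 - k) * k ^+ n.
Proof.
case/andP=> k0 k1 ha; have k1' : 1 - k != 0 by rewrite subr_eq0 gt_eqF.
pose e n := D / (1 - k) * k ^+ n.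
(* The drop of [e] equals the bound on the increment of [a], which is exactly what nests the
   intervals. *)
have eS n : e n - e n.+1 = D * k ^+ n by rewrite /e exprS; field.
have lo n : a n - e n <= a n.+1 - e n.+1.
  by have := eS n; have := ha n; rewrite ler_norml => /andP[]; lra.
have hi n : a n.+1 + e n.+1 <= a n + e n.
  by have := eS n; have := ha n; rewrite ler_norml => /andP[]; lra.
have e0 n : 0 <= e n.
  have D0 : 0 <= D.
    by have := ha 0%N; rewrite expr0 mulr1; apply: le_trans.
  by rewrite mulr_ge0 ?exprn_ge0// divr_ge0// subr_ge0 ltW.
(* Both endpoints are compared with those of the interval of index [maxn n m]. *)
have lohi n m : a n - e n <= a m + e m.
  have /nondecreasing_seqP/(_ _ _ (leq_maxl n m)) := lo.
  have /nonincreasing_seqP/(_ _ _ (leq_maxr n m)) := hi.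
  by have := e0 (maxn n m); lra.
exists (sup (range (fun n => a n - e n))) => n.
have s1 : a n - e n <= sup (range (fun n => a n - e n)).
  apply: ub_le_sup; last by exists n.
  by exists (a 0%N + e 0%N) => _ [m _ <-]; exact: lohi.
have s2 : sup (range (fun n => a n - e n)) <= a n + e n.
  by apply: ge_sup; [exists (a 0%N - e 0%N), 0%N|move=> _ [m _ <-]; exact: lohi].
by rewrite ler_norml -/(e n); apply/andP; split; lra.
Qed.

(** * Primitives of bounded functions, with calculus away from 0 *)

Definition primitive (R : realType) (f : R -> R) (c : R) : R :=
  (\int[lebesgue_measure]_(t in `[0, c]) f t)%R.

Lemma integrable_bounded_itv (R : realType) (f : R -> R) (M c : R) :
  measurable_fun setT f -> (forall t : R, 0 <= t -> `|f t| <= M) ->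
  (@lebesgue_measure R).-integrable `[0, c] (EFin \o f).
Proof.
move=> mf fM; apply: measurable_bounded_integrable => //.
- suff: (@lebesgue_measure R `[0%R, c]%classic < +oo)%E by [].
  by rewrite lebesgue_measure_itv/=; case: ifP => _; rewrite -?EFinB ltry.
- exact: measurable_funTS.
- exists M; split; first exact: num_real.
  move=> y My x /=; rewrite in_itv/= => /andP[x0 _].
  by rewrite (le_trans (fM _ x0))// ltW.
Qed.

Lemma norm_primitive_le (R : realType) (f : R -> R) (M c : R) :
  measurable_fun setT f -> (forall t : R, 0 <= t -> `|f t| <= M) -> 0 <= c ->
  `|primitive f c| <= M * c.
Proof.
move=> mf fM c0.
have fi := integrable_bounded_itv c mf fM.
apply: (le_trans (le_normr_Rintegral _ fi)) => //.
have -> : M * c = (\int[lebesgue_measure]_(t in `[0%R, c]) M)%R.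
  rewrite Rintegral_cst//; congr (_ * _).
  have -> : fine (@lebesgue_measure R `[0%R, c]%classic) = c; last by [].
  rewrite lebesgue_measure_itv/= lte_fin.
  by case: ltP => [_|]; rewrite /= ?subr0// => ?; apply/le_anti/andP.
apply: le_Rintegral => //.
- exact: integrable_norm.
- apply: (@integrable_bounded_itv _ (cst M) `|M|) => //.
- by move=> x; rewrite /= in_itv/= => /andP[/fM].
Qed.

Lemma is_derive_primitive (R : realType) (f : R -> R) (M c : R) :
  measurable_fun setT f -> (forall t : R, 0 <= t -> `|f t| <= M) -> 0 < c ->
  {for c, continuous f} -> is_derive c 1 (primitive f) (f c).
Proof.
move=> mf fM c0 cf.
(* The interval is prolonged to c + 1 so that c is an interior point. *)
have [||d dE] := @continuous_FTC1_closed _ f 0 c (c + 1) _ _ c0 cf.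
- by rewrite ltrDl.
- exact: integrable_bounded_itv mf fM.
- by split; [exact: d|rewrite -derive1E; exact: dE].
Qed.

Lemma linear_bound_cvg0 (R : realType) (F : R -> R) (M : R) :
  (forall t : R, 0 <= t -> `|F t| <= M * t) -> F t @[t --> 0^'+] --> 0.
Proof.
move=> FM.
have h : M * t @[t --> (0:R)^'+] --> 0.
  rewrite -[X in _ --> X](mulr0 M); apply: cvgMl_tmp; apply: cvg_at_right_filter.
  exact: cvg_id.
apply/norm_cvg0P; apply: (squeeze_cvgr _ (cvg_cst 0) h).
by near=> t; rewrite normr_ge0/= FM// ltW.
Unshelve. all: by end_near. Qed.

(* A comparison of derivatives, so that F' may be unbounded (and its
   integrability at 0 need not be established). *)
Lemma primitive_dominated (R : realType) (f F F' : R -> R) (M : R) :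
  measurable_fun setT f -> (forall t : R, 0 <= t -> `|f t| <= M) ->
  (forall t : R, 0 < t -> {for t, continuous f}) ->
  (forall t : R, 0 < t -> is_derive t 1 F (F' t)) ->
  (forall t : R, 0 < t -> `|f t| <= F' t) -> F t @[t --> 0^'+] --> 0 ->
  forall c : R, 0 < c -> `|primitive f c| <= F c.
Proof.
move=> mf fM cf dF fF F0 c c0.
have P0 : primitive f t @[t --> 0^'+] --> 0.
  by apply: (@linear_bound_cvg0 _ _ M) => t t0; exact: norm_primitive_le.
have dP (t : R) : 0 < t -> is_derive t 1 (primitive f) (f t).
  by move=> t0; apply: is_derive_primitive mf fM t0 (cf _ t0).
rewrite ler_norml -[X in X && _]subr_ge0 -[X in _ && X]subr_ge0 opprK.
apply/andP; split.
- apply: (@derive_nonneg_at0 _ (primitive f + F) (f + F')) => //.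
  + by move=> t t0; exact: (is_deriveD (dP t t0) (dF t t0)).
  + move=> t t0; rewrite -[leRHS]/(f t + F' t).
    by have := fF t t0; rewrite ler_norml/= => /andP[]; lra.
  + by rewrite -[X in _ --> X](addr0 0); exact: cvgD.
- apply: (@derive_nonneg_at0 _ (F - primitive f) (F' - f)) => //.
  + by move=> t t0; exact: (is_deriveB (dF t t0) (dP t t0)).
  + move=> t t0; rewrite -[leRHS]/(F' t - f t).
    by have := fF t t0; rewrite ler_norml/= => /andP[]; lra.
  + by rewrite -[X in _ --> X](subr0 0); exact: cvgB.
Qed.

Lemma primitiveE (R : realType) (f F : R -> R) (M : R) :
  measurable_fun setT f -> (forall t : R, 0 <= t -> `|f t| <= M) ->
  (forall t : R, 0 < t -> {for t, continuous f}) ->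
  (forall t : R, 0 < t -> is_derive t 1 F (f t)) -> F t @[t --> 0^'+] --> 0 ->
  forall c : R, 0 < c -> primitive f c = F c.
Proof.
move=> mf fM cf dF F0 c c0.
have P0 : primitive f t @[t --> 0^'+] --> 0.
  by apply: (@linear_bound_cvg0 _ _ M) => t t0; exact: norm_primitive_le.
have dP (t : R) : 0 < t -> is_derive t 1 (primitive f) (f t).
  by move=> t0; apply: is_derive_primitive mf fM t0 (cf _ t0).
apply/le_anti; rewrite -subr_ge0 -[X in _ && X]subr_ge0; apply/andP; split.
- apply: (@derive_nonneg_at0 _ (F - primitive f) (f - f)) => //.
  + by move=> t t0; exact: (is_deriveB (dF t t0) (dP t t0)).
  + by move=> t t0; rewrite -[leRHS]/(f t - f t) subrr.
  + by rewrite -[X in _ --> X](subr0 0); exact: cvgB.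
- apply: (@derive_nonneg_at0 _ (primitive f - F) (f - f)) => //.
  + by move=> t t0; exact: (is_deriveB (dP t t0) (dF t t0)).
  + by move=> t t0; rewrite -[leRHS]/(f t - f t) subrr.
  + by rewrite -[X in _ --> X](subr0 0); exact: cvgB.
Qed.

(** * The dilation mean: continuity, scaling, derivative, power bounds *)

Lemma measurable_dilate (R : realType) (m x : R) (h : R -> R) :
  continuous h -> measurable_fun setT (fun t : R => h (x * t `^ m)).
Proof.
move=> ch; apply: (measurableT_comp (continuous_measurable_fun ch)).
exact: (measurable_funM (measurable_cst x) (@measurable_powR R m)).
Qed.

Lemma continuous_dilate (R : realType) (m x : R) (h : R -> R) (t : R) :
  continuous h -> 0 < t -> {for t, continuous (fun t : R => h (x * t `^ m))}.
Proof.
move=> ch t0.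
apply: (@continuous_comp _ _ _ (fun t : R => x * t `^ m) h); last exact: ch.
have [/derivable1_diffP/differentiable_continuous cm _] := is_derive1_powR m t0.
by apply: cvgM => //; exact: cvg_cst.
Qed.

(** Continuity under the integral sign, dominated by the constant M: for each fixed t, including t =
    0, the integrand is continuous in y. *)
Lemma continuous_dilation_mean (R : realType) (m M : R) (h : R -> R) :
  continuous h -> (forall y, `|h y| <= M) -> continuous (dilation_mean m h).
Proof.
move=> ch hM x.
have ci := @continuity_under_integral R _ _ (@lebesgue_measure R)
  (fun y t => h (y * t `^ m)) `[0, 1]%classic _ (x - 1) (x + 1) _ _ (cst M).
apply: ci => //.
- move=> y _; apply: integrable_bounded_itv (measurable_dilate _ _ ch) _.
  by move=> t _; exact: hM.
- apply: aeW => t _ y _; apply: (@cvg_comp _ _ _ (fun y : R => y * t `^ m) h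
      (nbhs y) (nbhs (y * t `^ m))).
    by apply: cvgMr_tmp; exact: cvg_id.
  exact: ch.
- by apply: (@integrable_bounded_itv _ (cst M) `|M|) => //=.
- by move=> y _; apply: aeW => t _; exact: hM.
- by rewrite inE/= in_itv/= ltrBlDr !ltrDl ltr01.
Qed.

(** The substitution s = c t, carried out by checking that [primitive f (c * t) / c] is an
    antiderivative in t of the integrand on the left. It moves the dependence on the point into the
    upper limit of integration, where it can be differentiated. *)
Lemma dilation_mean_scale (R : realType) (m M : R) (h : R -> R) (x c : R) :
  continuous h -> (forall y, `|h y| <= M) -> 0 < c ->
  dilation_mean m h (x * c `^ m) = primitive (fun t => h (x * t `^ m)) c / c.
Proof.
move=> ch hM c0; pose f t := h (x * t `^ m).
have mf : measurable_fun setT f by exact: measurable_dilate.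
have fM t : 0 <= t -> `|f t| <= M by move=> _; exact: hM.
have := @primitiveE R (fun t => h (x * c `^ m * t `^ m))
  (fun t => primitive f (c * t) * c^-1) M.
move=> /(_ _ _ _ _ _ 1 ltr01); rewrite mulr1; apply.
- exact: measurable_dilate.
- by move=> t _; exact: hM.
- by move=> t t0; exact: continuous_dilate.
- move=> t t0.
  have dc : is_derive t 1 (fun t => c * t) c.
    by have := @is_deriveZ _ _ _ id c t 1 1 _; rewrite /GRing.scale/= mulr1; apply.
  have ct0 : 0 < c * t by rewrite mulr_gt0.
  have dP := is_derive_primitive mf fM ct0 (continuous_dilate ch ct0).
  have := is_deriveM (is_derive1_comp dP dc) (is_derive_cst c^-1 t 1).
  move=> dF; apply: (is_derive_eq dF); rewrite scaler0 add0r /GRing.scale/= mulrCA mulVf ?gt_eqF//.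
  by rewrite mulr1 /f powRM ?ltW// mulrA.
- apply: (@linear_bound_cvg0 _ _ M) => t t0.
  rewrite normrM [X in _ * X]gtr0_norm ?invr_gt0// ler_pdivrMr// -mulrA.
  by rewrite (mulrC t); apply: norm_primitive_le => //; rewrite mulr_ge0// ltW.
Qed.

(** With e(y) = y^(1/m), scaling from the base point 1 writes the mean at y as
    [primitive f (e y) / e y]; the product and chain rules then apply. Since e'(x) = e(x) / (m x),
    the derivative is the differential equation solved for w'. *)
Lemma is_derive_dilation_mean (R : realType) (m M : R) (h : R -> R) (x : R) :
  continuous h -> (forall y, `|h y| <= M) -> m != 0 -> 0 < x ->
  is_derive x 1 (dilation_mean m h) ((h x - dilation_mean m h x) / (m * x)).
Proof.
move=> ch hM m0 x0; pose f t := h (1 * t `^ m).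
pose e (y : R) := y `^ m^-1.
have mf : measurable_fun setT f by exact: measurable_dilate.
have fM t : 0 <= t -> `|f t| <= M by move=> _; exact: hM.
have eK (y : R) : 0 < y -> 1 * e y `^ m = y.
  by move=> y0; rewrite mul1r -powRrM mulVf// powRr1// ltW.
have WE (y : R) : 0 < y -> dilation_mean m h y = primitive f (e y) * (e y)^-1.
  by move=> y0; rewrite -[in LHS](eK _ y0) (dilation_mean_scale _ _ ch hM)// powR_gt0.
have ex0 : 0 < e x by exact: powR_gt0.
have de : is_derive x 1 e (e x / (m * x)).
  apply: (is_derive_eq (is_derive1_powR m^-1 x0)).
  rewrite powRB; last by rewrite (gt_eqF x0) implybT.
  by rewrite powRr1 ?ltW// /e invfM; ring.
have dP := is_derive_primitive mf fM ex0 (continuous_dilate ch ex0).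
have dV : is_derive x 1 (fun y => (e y)^-1) (- (e x) ^- 2 *: (e x / (m * x))).
  by apply: is_deriveV => //; rewrite gt_eqF.
have d := is_deriveM (is_derive1_comp dP de) dV.
have nW : {near x, (primitive f \o e) * (fun y => (e y)^-1) =1 dilation_mean m h}.
  near=> y; have y0 : 0 < y by near: y; exact: lt_nbhsr.
  exact: esym (WE y y0).
apply: (is_derive_eq (near_eq_is_derive nW d)); rewrite (WE _ x0) /GRing.scale/= /f eK//.
by field; rewrite m0 !gt_eqF.
Unshelve. all: by end_near. Qed.

(* The integrand h (x t^m) is the derivative of t v (x t^m). *)
Lemma dilation_mean_ode (R : realType) (m M M' : R) (h v dv : R -> R) (x : R) :
  continuous h -> (forall y, `|h y| <= M) ->
  (forall y, 0 < y -> `|v y| <= M') ->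
  (forall y : R, 0 < y -> is_derive y 1 v (dv y)) ->
  (forall y, 0 < y -> m * y * dv y + v y = h y) -> 0 < x ->
  v x = dilation_mean m h x.
Proof.
move=> ch hM vM dvE ode x0; apply/esym.
have := @primitiveE R (fun t => h (x * t `^ m)) (fun t => t * v (x * t `^ m)) M.
move=> /(_ _ _ _ _ _ 1 ltr01); rewrite powR1 mulr1 mul1r; apply.
- exact: measurable_dilate.
- by move=> t _; exact: hM.
- by move=> t t0; exact: continuous_dilate.
- move=> t t0; have xt0 : 0 < x * t `^ m by rewrite mulr_gt0// powR_gt0.
  have dx : is_derive t 1 (fun t => x * t `^ m) (x * (m * t `^ (m - 1))).
    by have := is_derive1_powR m t0; exact: is_deriveZ.
  have dvx := @is_derive1_comp _ v (fun t => x * t `^ m) _ _ _ (dvE _ xt0) dx.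
  have := is_deriveM (is_derive_id t 1) dvx.
  move=> dF; apply: (is_derive_eq dF); rewrite -(ode _ xt0) /GRing.scale/=.
  rewrite powRB; last by rewrite (gt_eqF t0) implybT.
  by rewrite powRr1 ?ltW//; field; rewrite gt_eqF.
- apply: (@linear_bound_cvg0 _ _ M') => t t0.
  rewrite normrM ger0_norm// mulrC; move: t0; rewrite le_eqVlt => /predU1P[<-|t0].
    by rewrite !mulr0.
  apply: ler_wpM2r; first exact: ltW.
  by apply: vM; rewrite mulr_gt0// powR_gt0.
Qed.

(** The integrand is dominated by A x^q t^(q m), with antiderivative A / (1 + q m) x^q t^(1 + q m);
    the latter tends to 0 at 0 because q m > -1. *)
Lemma dilation_mean_power (R : realType) (m M A q : R) (h : R -> R) (x : R) :
  continuous h -> (forall y, `|h y| <= M) -> 0 <= A ->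
  (forall y : R, 0 <= y -> `|h y| <= A * y `^ q) -> -1 < q * m -> 0 <= x ->
  `|dilation_mean m h x| <= A / (1 + q * m) * x `^ q.
Proof.
move=> ch hM A0 hA qm x0; have r0 : 0 < 1 + q * m by lra.
have := @primitive_dominated R (fun t => h (x * t `^ m))
  (fun t => A / (1 + q * m) * x `^ q * t `^ (1 + q * m))
  (fun t => A * (x * t `^ m) `^ q) M.
move=> /(_ _ _ _ _ _ _ 1 ltr01); rewrite powR1 mulr1; apply.
- exact: measurable_dilate.
- by move=> t _; exact: hM.
- by move=> t t0; exact: continuous_dilate.
- move=> t t0.
  have dt := is_derive1_powR (1 + q * m) t0.
  have dF : is_derive t 1 (fun t => A / (1 + q * m) * x `^ q * t `^ (1 + q * m))
    (A / (1 + q * m) * x `^ q * ((1 + q * m) * t `^ (1 + q * m - 1))).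
    exact: is_deriveZ.
  apply: (is_derive_eq dF); rewrite addrAC subrr add0r.
  rewrite powRM ?powR_ge0// -powRrM (mulrC m); field; rewrite gt_eqF//.
- by move=> t t0; apply: hA; rewrite mulr_ge0// powR_ge0.
- rewrite -[X in _ --> X](mulr0 (A / (1 + q * m) * x `^ q)).
  by apply: cvgMl_tmp; exact: powR_cvg0.
Qed.

(** * From the operator [Lop] to the contraction estimate *)

(** Powers are eigenfunctions of L: (a x)^q splits as a^q x^q, and integrating in a produces
    lambda(q). The bound M makes u(a x) integrable against the finite measure K. *)
Lemma Lop_power (R : realType)
    (K : {finite_measure set (measurableTypeR R) -> \bar R})
    (u : R -> R) (M C q x : R) :
  (lambda K q < +oo)%E -> {within Rplus, continuous u} ->
  (forall y, 0 <= y -> `|u y| <= M) ->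
  (forall y : R, 0 <= y -> u y <= C * y `^ q) -> 0 <= x ->
  Lop K u x <= C * fine (lambda K q) * x `^ q.
Proof.
move=> lfin cu uM uC x0; pose h (y : R) := u `|y|.
have ch : continuous h by apply/continuous_Rplus_norm.
have RE : Rplus = `[0, +oo[%classic :> set R.
  by apply/seteqP; split => y; rewrite /Rplus/= in_itv/= andbT.
have mR : measurable (Rplus : set (measurableTypeR R)) by rewrite RE.
have Rx (a : R) : Rplus a -> 0 <= a * x by move=> a0; rewrite mulr_ge0.
have -> : Lop K u x = (\int[K]_(a in Rplus) h (a * x))%R.
  apply: eq_Rintegral => a; rewrite inE => a0.
  by rewrite /h ger0_norm// Rx.
have ih : K.-integrable Rplus (EFin \o (fun a => h (a * x))).
  apply: measurable_bounded_integrable => //.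
  - by rewrite ltey_eq fin_num_measure.
  - apply: measurable_funTS.
    apply: (@continuous_measurable_fun R (fun a => h (a * x))) => a.
    apply: (@continuous_comp _ _ _ (fun a : R => a * x) h); last exact: ch.
    by apply: cvgMr_tmp; exact: cvg_id.
  - exists M; split; first exact: num_real.
    by move=> y My a a0 /=; rewrite (le_trans (uM _ _))// ltW.
have ip : K.-integrable Rplus (EFin \o (fun a => a `^ q)).
  apply/integrableP; split.
    by apply/measurable_EFinP; apply: measurable_funTS; exact: measurable_powR.
  apply: le_lt_trans lfin; rewrite /lambda le_eqVlt; apply/predU1P; left.
  by apply: eq_integral => a _; rewrite /= ger0_norm// powR_ge0.
have -> : C * fine (lambda K q) * x `^ q =
    (\int[K]_(a in Rplus) ((C * x `^ q) * a `^ q))%R.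
  by rewrite RintegralZl// mulrAC.
apply: le_Rintegral => //.
  exact: (integrableZl mR (C * x `^ q) ip).
move=> a a0; rewrite /h ger0_norm ?Rx// (le_trans (uC _ _)) ?Rx//.
by rewrite powRM// mulrAC mulrA.
Qed.

Lemma dilation_mean_norm (R : realType) (m : R) (g : R -> R) (x : R) :
  0 <= x -> dilation_mean m g x = dilation_mean m (fun y : R => g `|y|) x.
Proof.
by move=> x0; apply: eq_Rintegral => t _; rewrite ger0_norm// mulr_ge0// powR_ge0.
Qed.

Lemma U_even (R : realType) (g : R -> R) : U R g ->
  continuous (fun y : R => g `|y|) /\ forall y : R, `|g `|y| | <= 1.
Proof.
move=> [[cg _] g1]; split; first exact/continuous_Rplus_norm.
by move=> y; apply/(supnorm_le1 g).1.
Qed.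

Lemma dilation_mean_U (R : realType) (m : R) (g : R -> R) :
  U R g -> U R (dilation_mean m g).
Proof.
move=> Ug; have [ch h1] := U_even Ug.
apply: in_U.
- apply/continuous_Rplus_norm => x.
  have -> : (fun x : R => dilation_mean m g `|x|) =
            (fun x : R => dilation_mean m (fun y : R => g `|y|) `|x|).
    by apply/funext => y; rewrite dilation_mean_norm.
  apply: continuous_comp; first exact: norm_continuous.
  exact: (continuous_dilation_mean ch h1).
- apply/supnorm_le1 => x x0; rewrite dilation_mean_norm//.
  have := @norm_primitive_le _ _ 1 1 (measurable_dilate m x ch) _ ler01.
  by rewrite mulr1; apply => t _; exact: h1.
Qed.

(** Clearing the denominator q > 0 turns the spectral condition into lambda(q) < 1 + q m; as
    lambda(q) > 0, the right side is positive. *)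
Lemma spectral_contraction (R : realType)
    (K : {finite_measure set (measurableTypeR R) -> \bar R}) (q m : R) :
  0 < q -> (0 < lambda K q < +oo)%E -> spectral K q < m ->
  -1 < q * m /\ 0 <= fine (lambda K q) / (1 + q * m) < 1.
Proof.
move=> q0 /andP[l0 ly]; rewrite /spectral ltr_pdivrMr// mulrC => lm.
have l0' : 0 < fine (lambda K q) by exact: fine_gt0 (introT andP (conj l0 ly)).
have qm : 0 < 1 + q * m by lra.
split; first by lra.
by rewrite divr_ge0 ?ltW//= ltr_pdivrMr//; lra.
Qed.

(** The Lipschitz condition contributes the factor lambda(q) through [Lop_power], and averaging
    contributes 1 / (1 + q m) through [dilation_mean_power]. *)
Lemma dilation_mean_contraction (R : realType)
    (K : {finite_measure set (measurableTypeR R) -> \bar R})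
    (G : (R -> R) -> (R -> R)) (m q C : R) (u1 u2 : R -> R) :
  (forall u, U R u -> U R (G u)) -> L_Lipschitz K G ->
  (0 < lambda K q < +oo)%E -> -1 < q * m -> U R u1 -> U R u2 -> 0 <= C ->
  (forall x, 0 <= x -> `|u1 x - u2 x| <= C * x `^ q) ->
  forall x, 0 <= x -> `|dilation_mean m (G u1) x - dilation_mean m (G u2) x|
    <= C * (fine (lambda K q) / (1 + q * m)) * x `^ q.
Proof.
move=> GU GL /andP[l0 ly] qm U1 U2 C0 uC x x0.
have [ch1 h1] := U_even (GU _ U1); have [ch2 h2] := U_even (GU _ U2).
have [[c1 _] n1] := U1; have [[c2 _] n2] := U2.
pose h (y : R) := G u1 `|y| - G u2 `|y|.
have ch : continuous h by move=> y; apply: cvgB; [exact: ch1|exact: ch2].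
have h2b y : `|h y| <= 2.
  by rewrite (le_trans (ler_normB _ _))// -[leRHS]/(1 + 1) lerD ?h1 ?h2.
have -> : dilation_mean m (G u1) x - dilation_mean m (G u2) x
    = dilation_mean m h x.
  rewrite (dilation_mean_norm _ (G u1))// (dilation_mean_norm _ (G u2))//.
  apply/esym/RintegralB => //.
  - apply: (integrable_bounded_itv (M := 1)); first exact: measurable_dilate ch1.
    by move=> t _; exact: h1.
  - apply: (integrable_bounded_itv (M := 1)); first exact: measurable_dilate ch2.
    by move=> t _; exact: h2.
have l0' : 0 <= fine (lambda K q) by apply: fine_ge0; exact: ltW.
rewrite mulrA; apply: (dilation_mean_power ch h2b) => //.
  exact: mulr_ge0.
move=> y y0; rewrite /h (ger0_norm y0); apply: (le_trans (GL _ _ U1 U2 _ y0)).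
apply: (Lop_power (M := 2)) => //.
- apply/continuous_Rplus_norm => z; apply: cvg_norm; apply: cvgB.
    by move/continuous_Rplus_norm: c1; exact.
  by move/continuous_Rplus_norm: c2; exact.
- move=> z z0; rewrite normr_id (le_trans (ler_normB _ _))//.
  by rewrite -[leRHS]/(1 + 1) lerD//; exact/(supnorm_le1 _).1.
Qed.

(** * Lowering the exponent, and geometric limits *)

(** Up to x = 1 the smaller exponent gives the larger power; beyond 1 the uniform bound M suffices
    because x^q >= 1. *)
Lemma bigO_pow_min (R : realType) (y : R -> R) (M p q : R) :
  (forall x, 0 <= x -> `|y x| <= M) -> 0 < q <= p ->
  bigO_pow y p -> bigO_pow y q.
Proof.
move=> yM /andP[q0 qp] [C C0 yC]; exists (Num.max C M).
  by rewrite lt_max C0.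
move=> x x0; have [x1|x1] := leP x 1.
  have [->|xn0] := eqVneq x 0.
    by have := yC 0 (lexx _); rewrite !powR0 ?mulr0 ?gt_eqF// (lt_le_trans q0).
  apply: (le_trans (yC _ x0)); apply: ler_pM => //.
  - exact: ltW.
  - exact: powR_ge0.
  - by rewrite le_max lexx.
  - by apply: ger_powR; rewrite // lt0r xn0 x0.
apply: (le_trans (yM _ x0)); rewrite -[leLHS]mulr1; apply: ler_pM => //.
- exact: le_trans (yM _ x0).
- by rewrite le_max lexx orbT.
- by rewrite -(powRr0 x); apply: ler_powR; exact: ltW.
Qed.

Lemma geometric_le (R : realType) (a b c k : R) : 0 <= k < 1 ->
  (forall n, a <= b + c * k ^+ n) -> a <= b.
Proof.
move=> /andP[k0 k1] h; rewrite -[leRHS]addr0.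
have cv : geometric c k n @[n --> \oo] --> 0.
  by apply: cvg_geometric; rewrite ger0_norm.
apply: (cvgr_to_ge (cvgD (cvg_cst b) cv)).
by apply: nearW => n; exact: h.
Qed.

(** * Solutions and fixed points of the dilation mean *)

Lemma dilation_mean0 (R : realType) (g : R -> R) (x : R) :
  dilation_mean 0 g x = g x.
Proof.
have -> : dilation_mean 0 g x = (\int[lebesgue_measure]_(t in `[0%R, 1%R]) g x)%R.
  by apply: eq_Rintegral => t _; rewrite powRr0 mulr1.
rewrite Rintegral_cst//.
have -> : fine (@lebesgue_measure R `[0%R, 1%R]%classic) = 1; last exact: mulr1.
by rewrite lebesgue_measure_itv/= lte_fin ltr01 /= subr0.
Qed.

(** Brings both notions of solution to the one fixed-point equation used for uniqueness. The point x
    = 0 is left out because for m != 0 the differential equation is imposed only on x > 0. *)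
Lemma solution_mean (R : realType) (G : (R -> R) -> (R -> R)) (m : R)
    (v : R -> R) : U R v -> U R (G v) ->
  classical_solution G m v \/ integral_solution G m v ->
  forall x, 0 < x -> v x = dilation_mean m (G v) x.
Proof.
move=> Uv UG [[_]|[_ vE] x x0]; last exact/vE/ltW.
have [-> vE x x0|m0 [dv _ ode] x x0] := eqVneq m 0.
  by rewrite dilation_mean0 vE// ltW.
rewrite dilation_mean_norm ?ltW//; have [ch h1] := U_even UG.
apply: (@dilation_mean_ode _ _ _ 1 _ _ (derive1 v)) ch h1 _ _ _ x0.
- by move=> y y0; have [_ /supnorm_le1] := Uv; apply; exact: ltW.
- by move=> y y0; rewrite derive1E; apply/derivableP/dv.
- by move=> y y0; rewrite ode// gtr0_norm.
Qed.

(** A dilation mean of a continuous function is differentiable on x > 0, so the fixed-point equation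
    itself supplies the regularity; w' = (h - w) / (m x) is then continuous and is the required
    equation. *)
Lemma fixed_point_classical (R : realType) (G : (R -> R) -> (R -> R)) (m : R)
    (w : R -> R) : U R w -> U R (G w) ->
  (forall x, 0 <= x -> w x = dilation_mean m (G w) x) ->
  classical_solution G m w.
Proof.
move=> Uw UG wE; split; first by have [] := Uw.
have [m0|m0] := eqVneq m 0; first by move=> x x0; rewrite wE// m0 dilation_mean0.
have [ch h1] := U_even UG; set h := (fun y : R => G w `|y|) in ch h1.
have wE' y : 0 < y -> w y = dilation_mean m h y.
  by move=> y0; rewrite wE ?ltW// dilation_mean_norm// ltW.
have dw (x : R) : 0 < x -> is_derive x 1 w ((h x - w x) / (m * x)).
  move=> x0; rewrite wE'//.
  apply: near_eq_is_derive (is_derive_dilation_mean ch h1 m0 x0).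
  near=> y; have y0 : 0 < y by near: y; exact: lt_nbhsr.
  by rewrite wE'.
have dwE (x : R) : 0 < x -> derive1 w x = (h x - w x) / (m * x).
  by move=> x0; rewrite derive1E; have [_] := dw _ x0.
split => x x0; first by have [] := dw _ x0.
- have cw : {for x, continuous w}.
    by apply/differentiable_continuous/derivable1_diffP; have [] := dw _ x0.
  have cq : {for x, continuous (fun y : R => (h y - w y) / (m * y))}.
    apply: cvgM; first by apply: cvgB; [exact: ch|exact: cw].
    apply: cvgV; first by rewrite mulf_neq0// gt_eqF.
    by apply: cvgMl_tmp; exact: cvg_id.
  rewrite /prop_for /continuous_at dwE//; apply: cvg_trans cq; apply: near_eq_cvg.
  near=> y; have y0 : 0 < y by near: y; exact: lt_nbhsr.
  by rewrite dwE.
- rewrite dwE// /h gtr0_norm//; field.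
  by rewrite m0 gt_eqF.
Unshelve. all: by end_near. Qed.

(** * Fixed points in the weighted distance: uniqueness and existence *)

Section fixed_point.
Context (R : realType)
  (K : {finite_measure set (measurableTypeR R) -> \bar R})
  (G : (R -> R) -> (R -> R)) (m p : R).
Hypothesis GU : forall u, U R u -> U R (G u).
Hypothesis GL : L_Lipschitz K G.
Hypothesis p0 : 0 < p.
Hypothesis Kp : (0 < lambda K p < +oo)%E.
Hypothesis pm : spectral K p < m.

Let A u := dilation_mean m (G u).
Let k := fine (lambda K p) / (1 + p * m).

Let k01 : 0 <= k < 1.
Proof. by have [] := spectral_contraction p0 Kp pm. Qed.

Let AU u : U R u -> U R (A u).
Proof. by move=> Uu; exact/dilation_mean_U/GU. Qed.

Let A_contraction C u1 u2 : U R u1 -> U R u2 -> 0 <= C ->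
  (forall x, 0 <= x -> `|u1 x - u2 x| <= C * x `^ p) ->
  forall x, 0 <= x -> `|A u1 x - A u2 x| <= C * k * x `^ p.
Proof.
have [pm1 _] := spectral_contraction p0 Kp pm.
by move=> U1 U2; exact: dilation_mean_contraction GU GL Kp pm1 U1 U2.
Qed.

Lemma fixed_point_unique v w : U R v -> U R w ->
  (forall x, 0 < x -> v x = A v x) -> (forall x, 0 < x -> w x = A w x) ->
  bigO_pow (fun x => v x - w x) p -> forall x, 0 <= x -> v x = w x.
Proof.
move=> Uv Uw vA wA [C C0 vw] x x0; have /andP[k0 _] := k01.
have vwn n y : 0 <= y -> `|v y - w y| <= C * k ^+ n * y `^ p.
  elim: n y => [|n IHn] y y0; first by rewrite expr0 mulr1 vw.
  (* The fixed-point equations are available only for y > 0; at 0 the weighted bound already forces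
     v and w to coincide. *)
  have [y00|yn0] := eqVneq y 0.
    by have := vw 0 (lexx _); rewrite y00 powR0 ?gt_eqF// !mulr0.
  have yp : 0 < y by rewrite lt0r yn0.
  rewrite vA// wA// exprSr mulrA; apply: A_contraction => //.
  by rewrite mulr_ge0 ?exprn_ge0// ltW.
apply/eqP; rewrite -subr_eq0 -normr_le0; apply: (@geometric_le _ _ _ (C * x `^ p) _ k01) => n.
by rewrite add0r mulrAC vwn.
Qed.

Lemma fixed_point_exists w0 : U R w0 -> bigO_pow (fun x => A w0 x - w0 x) p ->
  exists w, [/\ U R w, forall x, 0 <= x -> w x = A w x
    & bigO_pow (fun x => w x - w0 x) p].
Proof.
move=> Uw0 [C C0 w0A]; have /andP[k0 k1] := k01.
pose W n := iter n A w0.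
have UW n : U R (W n) by elim: n => //= n; exact: AU.
have W_incr n x : 0 <= x -> `|W n.+1 x - W n x| <= C * x `^ p * k ^+ n.
  elim: n x => [|n IHn] x x0; first by rewrite expr0 mulr1 w0A.
  rewrite mulrAC exprSr mulrA; apply: (A_contraction (UW n.+1) (UW n)) => //.
    by rewrite mulr_ge0 ?exprn_ge0// ltW.
  by move=> y y0; rewrite mulrAC IHn.
(* Pointwise limits of the iterates are collected into one function, with default value 0 at
   negative points. *)
have /choice[w wW] : forall x, exists l, forall n, 0 <= x ->
    `|l - W n x| <= C / (1 - k) * k ^+ n * x `^ p.
  move=> x; have [x0|x0] := leP 0 x; last by exists 0.
  have [l lW] := geometric_increments_cvg k01 (fun n => W_incr n x x0).
  exists l => n _; apply: (le_trans (lW n)).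
  by rewrite [C * _]mulrC -!mulrA mulrC -!mulrA.
set D := C / (1 - k) in wW.
have D0 : 0 < D by rewrite divr_gt0// subr_gt0.
have cw : {within Rplus, continuous w}.
  apply/continuous_Rplus_norm => x; apply/cvgrPdist_le => /= e e0.
  (* On [0, |x| + 1] the error of the n-th iterate is at most b k^n, so convergence is uniform near
     |x| and a three-term estimate with e / 3 yields continuity of the limit. *)
  pose b := D * (`|x| + 1) `^ p.
  have /cvgrPdist_le/(_ _ (divr_gt0 e0 (ltr0n R 3)))[N _ hN] :
    geometric b k n @[n --> \oo] --> 0.
    by apply: cvg_geometric; rewrite ger0_norm.
  have {hN} := hN N (leqnn _); rewrite /= sub0r normrN => hN.
  have wN (y : R) : `|y| <= `|x| + 1 -> `|w `|y| - W N `|y| | <= e / 3%:R.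
    move=> yx; apply: (le_trans (wW _ N (normr_ge0 _))).
    apply: le_trans hN; apply: le_trans (ler_norm _).
    rewrite /b mulrAC; apply: ler_wpM2r; first exact: exprn_ge0.
    apply: ler_wpM2l; first exact: ltW.
    by apply: ge0_ler_powR; rewrite ?nnegrE ?addr_ge0// ltW.
  have [[/continuous_Rplus_norm cN _] _] := UW N.
  have /cvgrPdist_le/(_ _ (divr_gt0 e0 (ltr0n R 3))) := cN x.
  move=> cNx; near=> y.
  have h1 : `|w `|x| - W N `|x| | <= e / 3%:R by apply: wN; rewrite lerDl.
  have h2 : `|w `|y| - W N `|y| | <= e / 3%:R.
    apply: wN; near: y.
    have : `|y| @[y --> x] --> `|x| by apply: norm_continuous.
    by move/cvgr_le; apply; rewrite ltrDl.
  have h3 : `|W N `|x| - W N `|y| | <= e / 3%:R by near: y.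
  move: h1 h2 h3; rewrite !ler_norml; lra.
have Uw : U R w.
  apply: in_U => //; apply/supnorm_le1 => x x0.
  (* Each iterate is bounded by 1, and the error term disappears as n grows. *)
  apply: (@geometric_le _ _ _ (D * x `^ p) _ k01) => n.
  have -> : w x = W n x + (w x - W n x) by rewrite addrC subrK.
  rewrite (le_trans (ler_normD _ _))// lerD//; last by rewrite mulrAC wW.
  by have [_ /supnorm_le1] := UW n; exact.
exists w; split => //; last by exists D => // x x0; have := wW x 0%N x0; rewrite mulr1.
move=> x x0; apply/eqP; rewrite -subr_eq0 -normr_le0.
(* The factor 2 counts two errors of size D k^(n+1) x^p: the distance from w to the iterate n + 1,
   and the contracted distance from the iterate n to w. *)
apply: (@geometric_le _ _ _ (D * k * x `^ p * 2%:R) _ k01) => n.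
have -> : w x - A w x = (w x - W n.+1 x) + (A (W n) x - A w x) by rewrite /W/=; ring.
have h1 := wW x n.+1 x0.
have h2 : `|A (W n) x - A w x| <= D * k ^+ n * k * x `^ p.
  apply: (A_contraction (UW n) Uw) => //.
    by rewrite mulr_ge0 ?exprn_ge0// ltW.
  by move=> y y0; rewrite distrC wW.
rewrite (le_trans (ler_normD _ _))//; move: h1 h2; rewrite exprSr.
move=> h1 h2; apply: (le_trans (lerD h1 h2)); rewrite le_eqVlt; apply/predU1P; left.
by ring.
Unshelve. all: by end_near. Qed.

End fixed_point.

Theorem theorem7p1 (R : realType)
    (K : {finite_measure set (measurableTypeR R) -> \bar R})
    (hK : forall p : R, 0 <= p -> (0 < lambda K p < +oo)%E)
    (mus : R)
    (Gamma : {fun B R >-> B R})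
    (ha : Gamma @` U R `<=` U R)
    (hb : L_Lipschitz K Gamma)
    (w0 : R -> R)
    (w0_cont : {within Rplus, continuous w0})
    (w0_norm : (supnorm w0 <= 1)%E)
    (p : R) (p_gt0 : 0 < p) (p_mus : -1 < p * mus)
    (w0_approx :
      bigO_pow (fun x => dilation_mean mus (Gamma w0) x - w0 x) p)
    (p_spectral : spectral K p < mus) :
  exists w : R -> R,
    [/\ classical_solution Gamma mus w,
        (supnorm w <= 1)%E,
        bigO_pow (fun x => w x - w0 x) p
      & forall p1 : R, 0 < p1 -> spectral K p1 < mus ->
        forall v : R -> R,
          {within Rplus, continuous v} ->
          (supnorm v <= 1)%E ->
          bigO_pow (fun x => v x - w0 x) p1 ->
          classical_solution Gamma mus v \/ integral_solution Gamma mus v ->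
          forall x : R, 0 <= x -> v x = w x].
Proof.
have GU u : U R u -> U R (Gamma u) by move=> Uu; apply: ha; exists u.
have Uw0 : U R w0 by exact: in_U.
have [w [Uw wA ww0]] := fixed_point_exists GU hb p_gt0 (hK _ (ltW p_gt0))
  p_spectral Uw0 w0_approx.
exists w; split => //.
- exact: fixed_point_classical (GU _ Uw) wA.
- by have [] := Uw.
move=> p1 p1_gt0 p1_spectral v cv v1 vw0 vsol.
have Uv : U R v by exact: in_U.
have le1 u x : U R u -> 0 <= x -> `|u x| <= 1.
  by move=> [_ /supnorm_le1]; exact.
(* Functions in the unit ball differ by at most 2; this uniform bound is what permits lowering the
   exponent below. *)
have leB u x : U R u -> 0 <= x -> `|u x - w0 x| <= 2.
  move=> Uu x0; rewrite (le_trans (ler_normB _ _))//.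
  by rewrite -[leRHS]/(1 + 1) lerD// le1.
pose q := Num.min p p1.
have q_gt0 : 0 < q by rewrite lt_min p_gt0.
(* The minimum is one of p and p1, so it inherits the spectral inequality. *)
have q_spectral : spectral K q < mus by rewrite /q minEle; case: ifP.
have [C C0 hC] : bigO_pow (fun x => v x - w0 x) q.
  apply: bigO_pow_min vw0; first by move=> x; exact: leB.
  by rewrite q_gt0 ge_min lexx orbT.
have [C' C'0 hC'] : bigO_pow (fun x => w x - w0 x) q.
  apply: bigO_pow_min ww0; first by move=> x; exact: leB.
  by rewrite q_gt0 ge_min lexx.
apply: (fixed_point_unique GU hb q_gt0 (hK _ (ltW q_gt0)) q_spectral) => //.
- exact: solution_mean (GU _ Uv) vsol.
- by move=> x /ltW/wA.
exists (C + C'); first exact: addr_gt0.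
move=> x x0; rewrite mulrDl.
have -> : v x - w x = (v x - w0 x) - (w x - w0 x) by ring.
by rewrite (le_trans (ler_normB _ _))// lerD ?hC ?hC'.
Qed.
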